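(* Let $n\geq 8$ be an integer, and for $k\in\mathbb{N}$ with $1\le k\le [\frac{n}{2}]-1$ let $\Gamma=Cay(\mathbb{Z}_n,S_k)$ be the Cayley graph on the cyclic group $\mathbb{Z}_n$, where $S_1=\{1,n-1\}$, ..., $S_k=S_{k-1}\cup\{k,n-k\}$ are inverse closed subsets of $\mathbb{Z}_n-\{0\}$. If $n$ is an even integer and $k=\frac{n}{2}-1$, then the metric dimension of $\Gamma$ is $k+1$.
   Context: $[x]$ denotes the integer part of $x$. For a finite group $G$ and a subset $\Omega\subseteq G$ closed under inverses and not containing the identity, the Cayley graph $Cay(G,\Omega)$ has vertex set $G$ and edge set $\{\{x,y\} : x^{-1}y\in\Omega\}$ (for the additive group $\mathbb{Z}_n$, $x^{-1}y$ means $y-x$). For a finite connected graph $\Gamma$ with graph distance $d$, a set $W=\{w_1,\dots,w_l\}$ of vertices is a resolving set if the vectors $r(v|W)=(d(v,w_1),\dots,d(v,w_l))$, $v\in V(\Gamma)$, are pairwise distinct. The metric dimension $\beta(\Gamma)$ is the minimum cardinality of a resolving set of $\Gamma$. *)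

(* Defs.v *)
From HB Require Import structures.
From mathcomp Require Import all_boot all_order all_fingroup all_algebra.
Set Implicit Arguments.
Unset Strict Implicit.
Unset Printing Implicit Defensive.

(* A graph on a finite vertex type is given by its adjacency relation. *)

(* Symmetric and irreflexive when Omega is closed under inverses and does not
   contain 1, as is required of a connection set. *)
Definition Cay (gT : finGroupType) (Omega : {set gT}) : rel gT :=
  fun x y => (x^-1 * y)%g \in Omega.

Definition walk (T : finType) (e : rel T) (x y : T) (m : nat) : bool :=
  [exists p : m.-tuple T, path e x p && (last x p == y)].

(* Least length of a walk from x to y.  A shortest walk has fewer than #|T|
   edges, so the search range suffices; the value is #|T| when y is not
   reachable from x, which does not occur in a connected graph. *)
Definition dist (T : finType) (e : rel T) (x y : T) : nat :=
  find (walk e x y) (iota 0 #|T|).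

Definition dist_vector (T : finType) (e : rel T) (W : {set T}) (v : T) :
    seq nat :=
  [seq dist e v w | w <- enum W].

Definition resolving (T : finType) (e : rel T) (W : {set T}) : bool :=
  injectiveb (dist_vector e W).

(* The full vertex set is resolving, so the minimum is over a nonempty family. *)
Definition metric_dim (T : finType) (e : rel T) : nat :=
  #|[arg min_(W < [set: T] | resolving e W) #|W| ]%N|.

(* Meant for 1 < n, since 'Z_0 and 'Z_1 are both Z/2; the group law of the
   finGroupType 'Z_n is addition.  The recursion starts from S_0 = set0, which
   gives S_1 = {1, n - 1}. *)
Fixpoint conn_set (n k : nat) : {set 'Z_n} :=
  if k is k'.+1 then conn_set n k' :|: [set k%:R%R; (n - k)%:R%R] else set0.

(* Main.v *)
Require Import Defs.
From mathcomp Require Import all_boot all_order all_fingroup all_algebra.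
From mathcomp Require Import zify.
Import GRing.Theory.

(** For [n = 2m] and [k = m - 1] every nonzero residue except [m] is a
    generator, so the graph is complete minus the perfect matching
    [x -- x + m]: matched vertices are at distance 2 and all other distinct
    vertices at distance 1.  Two matched vertices are told apart only by
    landmarks among themselves, so a resolving set meets every matched pair;
    conversely, any set with one vertex from each pair is resolving. *)

Section Walks.
Variables (T : finType) (e : rel T).

Lemma walk0E (x y : T) : walk e x y 0 = (x == y).
Proof.
apply/existsP/idP => [[p]|xy]; first by rewrite tuple0.
by exists [tuple].
Qed.

Lemma walkSE (x y : T) (m : nat) :
  walk e x y m.+1 = [exists z, e x z && walk e z y m].
Proof.
apply/existsP/existsP => [[p]|[z /andP[exz /existsP[p /andP[pz py]]]]].
  case/tupleP: p => z p /= /andP[/andP[exz pz] py]; exists z.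
  by rewrite exz; apply/existsP; exists p; rewrite pz.
by exists [tuple of z :: p]; rewrite /= exz pz.
Qed.

Lemma walk1E (x y : T) : walk e x y 1 = e x y.
Proof.
rewrite walkSE; apply/existsP/idP => [[z]|exy].
  by rewrite walk0E => /andP[exz /eqP <-].
by exists y; rewrite exy walk0E eqxx.
Qed.

Lemma resolvingP (W : {set T}) :
  reflect (forall x y, {in W, forall w, dist e x w = dist e y w} -> x = y)
          (resolving e W).
Proof.
apply: (iffP (injectiveP _)) => inj x y.
  by move=> eq_xy; apply/inj/eq_in_map => w; rewrite mem_enum; apply: eq_xy.
by move/eq_in_map=> eq_xy; apply: inj => w wW; apply: eq_xy; rewrite mem_enum.
Qed.

End Walks.

Section CompleteMinusMatching.
Variables (T : finType) (e : rel T) (s : T -> T).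
Hypotheses (s_invol : involutive s) (s_free : forall x, s x != x).
Hypothesis eE : forall x y, e x y = (y != x) && (y != s x).
Hypothesis T_gt2 : 2 < #|T|.

(** A third vertex [z] is adjacent to both [x] and [s x], which gives the walk of length 2 between
    matched vertices. *)
Lemma dist_matching (x y : T) :
  dist e x y = if y == x then 0 else if y == s x then 2 else 1.
Proof.
have s_inj := inv_inj s_invol.
(* With at least three vertices the search range contains 0, 1 and 2, so [find] unfolds that far. *)
rewrite /dist; case: #|T| T_gt2 => [|[|[|t]]] //= _.
rewrite walk0E walk1E eE eq_sym; case: eqVneq => //= _.
case: eqVneq => //= ->; suff -> : walk e x (s x) 2 by [].
have [z] : exists z, z \notin [set x; s x].
  apply/existsP; rewrite -negb_forall; apply: contraTN T_gt2 => /forallP all_xs.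
  rewrite -leqNgt -cardsT (leq_trans (subset_leq_card (_ : _ \subset [set x; s x]))) //.
    by apply/subsetP => z _; apply: all_xs.
  by rewrite cards2; case: (_ != _).
rewrite !inE negb_or => /andP[zx zsx].
rewrite walkSE; apply/existsP; exists z.
by rewrite eE zx zsx walk1E eE eq_sym zsx (inj_eq s_inj) eq_sym.
Qed.

(** If [x] is a landmark, only [x] is at distance 0 from it; otherwise [s x] is a landmark, and only
    [x] is at distance 2 from it. *)
Lemma resolving_transversal (W : {set T}) :
  (forall x, (s x \in W) = (x \notin W)) -> resolving e W.
Proof.
move=> sW; apply/resolvingP => x y eq_xy.
case: (boolP (x \in W)) => xW.
  move: (eq_xy x xW); rewrite !dist_matching eqxx.
  by case: eqP => // _; case: eqP.
move: (eq_xy (s x)); rewrite sW xW !dist_matching eqxx (negbTE (s_free x)).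
move=> /(_ isT); case: eqP => // _; case: eqP => // /(inv_inj s_invol) //.
Qed.

Lemma resolving_meets_pair (W : {set T}) (x : T) :
  resolving e W -> (x \in W) || (s x \in W).
Proof.
move=> /resolvingP resW; apply: contraNT (s_free x).
rewrite negb_or => /andP[xW sxW]; apply/eqP/resW => w wW.
have [wx wsx] : w != x /\ w != s x by split; apply: contraTneq wW => ->.
by rewrite !dist_matching s_invol (negbTE wx) (negbTE wsx).
Qed.

(** Since [W] meets every pair, [W] and its image under [s] cover [T]. *)
Lemma resolving_card (W : {set T}) : resolving e W -> #|T| <= #|W|.*2.
Proof.
move=> resW; rewrite -addnn -{2}(card_imset W (inv_inj s_invol)).
apply: leq_trans (leq_card_setU _ _); rewrite -cardsT.
apply/subset_leq_card/subsetP => x _; rewrite inE.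
case/orP: (resolving_meets_pair _ x resW) => [-> //|sxW].
by apply/orP; right; rewrite -(s_invol x) imset_f.
Qed.

Lemma metric_dim_matching (W : {set T}) :
  (forall x, (s x \in W) = (x \notin W)) -> (metric_dim e).*2 = #|T|.
Proof.
move=> sW; rewrite /metric_dim; case: arg_minnP => [|V resV minV].
  (* The default [[set: T]] of the minimum is resolving: the landmark [x] itself singles out [x]. *)
  apply/resolvingP => x y /(_ x (in_setT x)).
  by rewrite !dist_matching eqxx; case: eqP => // _; case: eqP.
apply/eqP; rewrite eqn_leq resolving_card // andbT.
have le_VW := minV W (resolving_transversal W sW).
apply: leq_trans (_ : #|W|.*2 <= _); first by rewrite leq_double.
(* [s] injects [W] into its complement, so [W] fills at most half of [T]. *)
rewrite -addnn -(cardsC W) leq_add2l -(card_imset W (inv_inj s_invol)).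
by apply/subset_leq_card/subsetP => _ /imsetP[x xW ->]; rewrite inE sW xW.
Qed.

End CompleteMinusMatching.

Lemma mem_conn_set (n k : nat) (x : 'Z_n) : 1 < n -> k < n ->
  (x \in conn_set n k) = (0 < x <= k) || (n - k <= x).
Proof.
move=> n_gt1; have x_lt : x < n by rewrite -[X in _ < X](Zp_cast n_gt1).
elim: k => [|k IHk] k_lt; first by rewrite inE; lia.
rewrite /= !inE IHk ?(ltnW k_lt) // -!val_eqE /= !val_Zp_nat //.
(* The bound on [k] keeps both new representatives below [n], so neither wraps around. *)
rewrite !modn_small; lia.
Qed.

Theorem theorem3p5 (n k : nat) (hn : 8 <= n)
    (hk1 : 1 <= k) (hk2 : k <= n./2 - 1)
    (n_even : ~~ odd n) (hk : k = n./2 - 1) :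
  metric_dim (Cay (conn_set n k)) = k + 1.
Proof.
have n_gt1 : 1 < n by lia.
have Zn := Zp_cast n_gt1.
have lt_n (x : 'Z_n) : x < n by rewrite -[X in _ < X]Zn.
pose h : 'Z_n := (n./2)%:R%R.
have hE : h = n./2 :> nat by rewrite val_Zp_nat // modn_small; lia.
have addE (x y : 'Z_n) : (x + y)%R = (x + y) %% n :> nat.
  exact: (congr1 (modn (x + y)) Zn).
pose s (x : 'Z_n) : 'Z_n := (x + h)%R.
have hh : (h + h = 0)%R.
  by apply/ord_inj; rewrite addE hE addnn even_halfK // modnn.
have s_invol : involutive s by move=> x; rewrite /s -addrA hh addr0.
have h_neq0 : h != 0%R by rewrite -val_eqE /= hE; lia.
have s_free x : s x != x by rewrite /s -subr_eq0 addrAC subrr add0r.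
have eE (x y : 'Z_n) : Cay (conn_set n k) x y = (y != x) && (y != s x).
  have -> : Cay (conn_set n k) x y = ((y - x)%R \in conn_set n k).
    by rewrite /Cay addrC.
  have -> : (y == s x) = (y - x == h)%R by rewrite subr_eq addrC.
  have -> : (y == x) = (y - x == 0)%R by rewrite subr_eq0.
  (* Only the difference [d] matters. As [n] is even, [n - k] is [n./2 + 1], so the two ranges of
     generators omit exactly 0 and [n./2]. *)
  have := lt_n (y - x)%R; move: (y - x)%R => d d_lt.
  rewrite mem_conn_set; [|lia..].
  by rewrite -!val_eqE /= hE; lia.
(* The lower half of the residues contains one vertex of each antipodal pair. *)
pose W := [set z : 'Z_n | z < n./2].
have sW x : (s x \in W) = (x \notin W).
  rewrite !inE addE hE -leqNgt; have := lt_n x.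
  case: (ltnP x n./2) => xh xn; first by rewrite modn_small; lia.
  rewrite (_ : x + n./2 = x - n./2 + n); last by lia.
  by rewrite modnDr modn_small; lia.
have card_Zn : #|'Z_n| = n by rewrite card_ord Zn.
have Zn_gt2 : 2 < #|'Z_n| by rewrite card_Zn; lia.
have := metric_dim_matching _ _ s s_invol s_free eE Zn_gt2 W sW.
rewrite card_Zn => dimE.
(* Here [k + 1] is [n./2], whose double is [n] by evenness. *)
apply: double_inj; rewrite dimE; lia.
Qed.
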